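(* Consider the two-period model $$Y_t=h_t(\alpha+X_t\beta-U_t),\qquad t=1,2,$$ where $\alpha$ is a real random variable, $X_t$ is a random $1\times K$ row vector, $\beta\in\mathbb{R}^K$, $X=(X_1,X_2)$, $Y=(Y_1,Y_2)$, and $F_t(u\mid\alpha,X)$ denotes the conditional CDF of $U_t$ given $(\alpha,X)$. Suppose the joint distribution of $(Y,X)$ is observed and that: (A1) for each $t$, $h_t:\mathbb{R}\to\mathcal{Y}$ is unknown, non-decreasing, right continuous and non-constant; (A2) (i) $F_1(u\mid\alpha,X)=F_2(u\mid\alpha,X)\equiv F(u\mid\alpha,X)$ for all $(\alpha,X)$; (ii) the support of $F(\cdot\mid\alpha,X)$ is $\mathbb{R}$ for all $(\alpha,X)$; (A3) with $\Delta X=X_2-X_1$ and $W=(\Delta X,-1)$: (i) at least one component of $\Delta X$ has, with probability one, a positive Lebesgue density on $\mathbb{R}$ conditional on all the other components of $\Delta X$, and the corresponding component of $\beta$ is non-zero; (ii) the support of $W$ is not contained in any proper linear subspace of $\mathbb{R}^{K+1}$; (A4) for every $(y_1,y_2)\in\underline{\mathcal{Y}}^2$, $(\beta,\,h_2^-(y_2)-h_1^-(y_1))\in\mathcal{B}\times\mathbb{R}$, where $\mathcal{B}=\{\beta\in\mathbb{R}^K:\|\beta\|=1\}$; (4a) $h_1$ and $h_2$ are strictly increasing; (4b) there is an unknown constant $m\in\mathbb{R}$ such that $E(U_t\mid X=x)=m$ for all $x\in\mathcal{X}$ and $t=1,2$. Let $\mu(x)=E[\alpha\mid X=x]$ for $x\in\mathcal{X}$,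 fix an arbitrary $y_0\in\underline{\mathcal{Y}}$, and let $c_1=h_1^{-1}(y_0)$ and $g_t(y)=h_t^{-1}(y)-c_1$ for $y\in\underline{\mathcal{Y}}$, $t=1,2$. Then, for any $x,x'\in\mathcal{X}$, the change in the conditional mean function $\mu(x)-\mu(x')$ is identified and given, for $t=1,2$, by $$\mu(x)-\mu(x')=E\left[g_t(Y_t)-X_t\beta\mid X=x\right]-E\left[g_t(Y_t)-X_t\beta\mid X=x'\right].$$
   Context: The set $\mathcal{Y}\subseteq\mathbb{R}$ is the (known) support of $Y_t$, understood as the set of values $h_t(\mathbb{R})$, the same for $t=1,2$; the support of the latent variable $\alpha+X_t\beta-U_t$ is $\mathbb{R}$. Set $\underline{\mathcal{Y}}=\mathcal{Y}\setminus\{\inf\mathcal{Y}\}$. The generalized inverse of $h_t$ is $h_t^-(y)=\inf\{y^*\in\mathbb{R}: y\le h_t(y^* )\}$, $y\in\mathcal{Y}$ (with the convention $\inf\emptyset=\inf\mathcal{Y}$); when $h_t$ is strictly increasing, $h_t^{-1}$ denotes its inverse on $\mathcal{Y}$. $\mathcal{X}$ denotes the support of $X$. The conditional expectations appearing in the statement are assumed to exist and be finite; statements about conditional expectations given $X=x$ are understood for the usual versions (almost everywhere in $x$). $(\alpha,U_1,U_2)$ are unobserved; no restriction is placed on the joint distribution of $(\alpha,X)$ other than those stated, and $U_1,U_2$ may be dependent. No location normalization is imposed on $h_1$. A structure consists of $(\beta,h_1,h_2)$ together with a joint distribution of $(\alpha,X,U_1,U_2)$. A functional of the structure is ''identified''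 if any two structures that both satisfy the model and all the stated assumptions and that generate the same joint distribution of $(Y,X)$ give the same value of that functional. *)

(* Defs.v *)
From HB Require Import structures.
From mathcomp Require Import all_boot all_order all_algebra.
From mathcomp Require Import all_classical all_reals all_analysis.

Set Implicit Arguments.
Unset Strict Implicit.
Unset Printing Implicit Defensive.

Import Order.TTheory GRing.Theory Num.Theory.
Import numFieldNormedType.Exports.

Local Open Scope classical_set_scope.
Local Open Scope ring_scope.

(* The Borel sigma-algebra of R^n, generated by the coordinate maps. *)
Section measurable_rV.
Context {R : realType} (n : nat).

Let coord (i : 'I_n) (v : 'rV[R]_n) : R := v ord0 i.

Let rV_set0 : g_sigma_preimage coord set0.
Proof. exact: sigma_algebra0. Qed.

Let rV_setC A : g_sigma_preimage coord A -> g_sigma_preimage coord (~` A).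
Proof. exact: sigma_algebraC. Qed.

Let rV_bigcup (F : (set 'rV[R]_n)^nat) :
  (forall i, g_sigma_preimage coord (F i)) ->
  g_sigma_preimage coord (\bigcup_i (F i)).
Proof. exact: sigma_algebra_bigcup. Qed.

HB.instance Definition _ := @isMeasurable.Build default_measure_display
  'rV[R]_n (g_sigma_preimage coord) rV_set0 rV_setC rV_bigcup.

End measurable_rV.

Definition msupport {R : realType} {T : topologicalType}
    (mu : set T -> \bar R) : set T :=
  [set x | forall V : set T, open V -> V x -> (0 < mu V)%E].

Section conditioning.
Context {d d' d''} {Omega : measurableType d} {S : measurableType d'}
  {T : measurableType d''} {R : realType}.
Variable P : probability Omega R.

(* k is a regular conditional distribution of Z given X. *)
Definition is_cond_law (Z : Omega -> S) (X : Omega -> T)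
    (k : R.-pker T ~> S) : Prop :=
  forall (A : set S) (B : set T), measurable A -> measurable B ->
    P (Z @^-1` A `&` X @^-1` B) = (\int[pushforward P X]_(x in B) k x A)%E.

End conditioning.

(* m is a version of x |-> E[Z | X = x], which exists and is finite for almost
   every x: the mean of a regular conditional distribution of Z given X = x.
   Z itself need not be integrable. *)
Definition is_cond_mean {d d'} {Omega : measurableType d}
    {T : measurableType d'} {R : realType} (P : probability Omega R)
    (Z : Omega -> R) (X : Omega -> T) (m : T -> R) : Prop :=
  exists k : R.-pker T ~> R, is_cond_law P Z X k /\
    {ae pushforward P X, forall x,
      (k x).-integrable setT (EFin : R -> \bar R) /\
      (\int[k x]_z z%:E = (m x)%:E)%E}.

(* The library norm on matrices is the sup norm. *)
Definition eucl_norm {R : realType} {n : nat} (v : 'cV[R]_n) : R :=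
  Num.sqrt (\sum_(i < n) v i ord0 ^+ 2).

(* The infimum of Y is taken in the extended reals: nothing is removed when Y
   is unbounded below. *)
Definition under {R : realType} (Y : set R) : set R :=
  [set y | Y y /\ y%:E <> ereal_inf [set z%:E | z in Y]].

Definition geninv {R : realType} (Y : set R) (h : R -> R) (y : R) : \bar R :=
  let S := [set z : R | y <= h z] in
  if S == set0 then ereal_inf [set z%:E | z in Y]
  else ereal_inf [set z%:E | z in S].

Variant period := t1 | t2.

Definition at_period {A : Type} (t : period) (p : A * A) : A :=
  match t with t1 => p.1 | t2 => p.2 end.

(* The values (a, (x_1, x_2)) of (alpha, X), and the values
   ((a, (x_1, x_2)), (u_1, u_2)) of (alpha, X, U_1, U_2). *)
Notation covariates R K := ('rV[R]_K * 'rV[R]_K)%type.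
Notation outcomes R K := ((R * covariates R K) * (R * R))%type.

(* Only the joint law of (alpha, X, U_1, U_2) matters, so these variables are
   the coordinate projections of the space that carries it. *)
Record structure (R : realType) (K : nat) := Structure {
  beta : 'cV[R]_K;
  trans : period -> R -> R;
  joint : probability (outcomes R K) R }.

Section variables.
Context {R : realType} {K : nat}.
Implicit Types (t : period) (w : outcomes R K).

Definition alpha w : R := w.1.1.
Definition Xall w : covariates R K := w.1.2.
Definition X t w : 'rV[R]_K := at_period t (Xall w).
Definition U t w : R := at_period t w.2.
Definition alphaX w : R * covariates R K := (alpha w, Xall w).

Definition dX w : 'rV[R]_K := X t2 w - X t1 w.
Definition W w : 'rV[R]_(K + 1) := row_mx (dX w) (const_mx (-1)).

Variable s : structure R K.

Definition Xbeta t w : R := (X t w *m beta s) ord0 ord0.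
Definition Y t w : R := trans s t (alpha w + Xbeta t w - U t w).

Definition observables w : (R * R) * covariates R K :=
  ((Y t1 w, Y t2 w), Xall w).

Definition law_X : set (covariates R K) -> \bar R := pushforward (joint s) Xall.
Definition supp_X : set (covariates R K) := msupport law_X.

Definition hinv t : R -> R := 'pinv_(fun=> 0) [set: R] (trans s t).

Definition g (y0 : R) t (y : R) : R := hinv t y - hinv t1 y0.

End variables.

Section assumptions.
Context {R : realType} {K : nat}.
Variables (Ysupp : set R) (s : structure R K).

Definition A1 : Prop := forall t,
  [/\ range (trans s t) = Ysupp,
      {homo trans s t : x y / x <= y},
      right_continuous (trans s t) &
      exists x y, trans s t x <> trans s t y].

(* Suitable versions F t of the conditional laws of U_t given (alpha, X) have the
   required properties everywhere, not only almost everywhere. *)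
Definition A2 : Prop :=
  exists F : period -> R.-pker (R * covariates R K)%type ~> R,
  [/\ forall t, is_cond_law (joint s) (U t) alphaX (F t),
      forall z (u : R), F t1 z `]-oo, u]%classic = F t2 z `]-oo, u]%classic &
      forall t z, msupport (F t z) = setT].

(* [col' k] deletes the k-th component. *)
Definition A3i : Prop :=
  exists k : 'I_K, beta s k ord0 <> 0 /\
  exists L : R.-pker 'rV[R]_K.-1 ~> R,
    is_cond_law (joint s) (fun w => dX w ord0 k) (fun w => col' k (dX w)) L /\
    {ae pushforward (joint s) (fun w => col' k (dX w)), forall z,
      exists f : R -> R,
      [/\ measurable_fun setT f, forall v, 0 < f v &
          forall A : set R, measurable A ->
            L z A = (\int[lebesgue_measure]_(v in A) (f v)%:E)%E]}.

Definition A3ii : Prop :=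
  forall V : {vspace 'rV[R]_(K + 1)}, V <> fullv ->
    ~ (msupport (pushforward (joint s) W) `<=` [set v | v \in V]).

Definition A4 : Prop := forall y1 y2, under Ysupp y1 -> under Ysupp y2 ->
  eucl_norm (beta s) = 1 /\
  (geninv Ysupp (trans s t2) y2 - geninv Ysupp (trans s t1) y1)%E \is a fin_num.

Definition A4a : Prop := forall t, {homo trans s t : x y / x < y}.

Definition A4b : Prop :=
  exists m : R, forall t, is_cond_mean (joint s) (U t) Xall (fun=> m).

Definition admissible : Prop := [/\ A1, A2, A3i /\ A3ii, A4 & A4a /\ A4b].

End assumptions.

Definition same_observables {R : realType} {K : nat} (s s' : structure R K) :=
  forall A : set ((R * R) * covariates R K), measurable A ->
    joint s (observables s @^-1` A) = joint s' (observables s' @^-1` A).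

(* Functions of x and x' defined through conditional expectations given X are
   only determined for x and x' outside a P_X-null set. *)
Definition ae_equal {R : realType} {K : nat} (s : structure R K)
    (D D' : covariates R K -> covariates R K -> R) : Prop :=
  exists N, (law_X s).-negligible N /\
    forall x x', (supp_X s `\` N) x -> (supp_X s `\` N) x' -> D x x' = D' x x'.

(* A functional of the structure given by its versions: [val s D] states that
   D is a version of its value at s. *)
Definition identified {R : realType} {K : nat} (adm : structure R K -> Prop)
    (val : structure R K -> (covariates R K -> covariates R K -> R) -> Prop) :=
  forall s s', adm s -> adm s' -> same_observables s s' ->
  forall D D', val s D -> val s' D' -> ae_equal s D D'.

(* D is a version of (x, x') |-> E[Z | X = x] - E[Z | X = x']. *)
Definition is_cond_mean_diff {R : realType} {K : nat} (s : structure R K)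
    (Z : outcomes R K -> R) (D : covariates R K -> covariates R K -> R) : Prop :=
  exists m, is_cond_mean (joint s) Z Xall m /\ D = fun x x' => m x - m x'.

(* Main.v *)
Require Import Defs.
From HB Require Import structures.
From mathcomp Require Import all_boot all_order all_algebra.
From mathcomp Require Import all_classical all_reals all_analysis.
From mathcomp Require Import measurable_realfun.
From mathcomp Require Import ring lra.

Set Implicit Arguments.
Unset Strict Implicit.
Unset Printing Implicit Defensive.

Import Order.TTheory GRing.Theory Num.Theory.
Import numFieldNormedType.Exports.

Local Open Scope classical_set_scope.
Local Open Scope ring_scope.

(* Put z_t for the value of the latent variable at which h_t reaches y_t. Given
   (alpha, X), the event {y_t <= Y_t} is {U_t <= alpha + X_t beta - z_t}, and
   both periods share one strictly increasing conditional CDF; so on a set of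
   values of X the observable probabilities P(y_2 <= Y_2), P(y_1 <= Y_1) are
   ordered as dX beta and z_2 - z_1 are. Two structures with the same
   observables therefore give dX beta - (z_2 - z_1) the same sign almost surely.
   Along the component of dX with positive density, two affine functions whose
   signs agree almost everywhere are proportional with a nonnegative factor; the
   support condition on W turns this into proportionality of (beta, z_2 - z_1),
   and the normalisation of beta into equality. Hence h_2(. + c_1) is common to
   both structures, and alpha - U_2 - c_1, being one and the same function of
   (Y, X) in both, has the same joint law with X. Its conditional mean is
   mu - m - c_1, so mu is determined up to an additive constant. *)

(** * Disintegration along a regular conditional law *)

Lemma pker_le1 {d d'} {T : measurableType d} {S : measurableType d'}
    {R : realType} (k : R.-pker T ~> S) x A :
  measurable A -> (k x A <= 1)%E.
Proof. by move=> mA; rewrite -(prob_kernel (s:=k) x) le_measure ?inE. Qed.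

Lemma pker_fin_num {d d'} {T : measurableType d} {S : measurableType d'}
    {R : realType} (k : R.-pker T ~> S) x A :
  measurable A -> k x A \is a fin_num.
Proof.
by move=> mA; rewrite ge0_fin_numE// (le_lt_trans (pker_le1 k x mA)) ?ltey.
Qed.

Section laws.
Context {d d'} {Omega : measurableType d} {T : measurableType d'} {R : realType}.

Lemma exists_law (P : probability Omega R) (X : Omega -> T) :
  measurable_fun setT X ->
  exists Q : probability T R, Q = pushforward P X :> (set T -> \bar R).
Proof.
move=> mX.
pose X' : {mfun Omega >-> T} := HB.pack X (isMeasurableFun.Build _ _ _ _ X mX).
by exists (distribution P X').
Qed.

End laws.

Section disintegration.
Context {d d' d''} {Omega : measurableType d} {S : measurableType d'}
  {T : measurableType d''} {R : realType}.
Variables (P : probability Omega R) (Z : Omega -> S) (X : Omega -> T).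
Variable k : R.-pker T ~> S.
Hypotheses (mZ : measurable_fun setT Z) (mX : measurable_fun setT X).
Hypothesis Pk : is_cond_law P Z X k.

Let measurable_ZX C : measurable C ->
  measurable ((fun w => (X w, Z w)) @^-1` C).
Proof.
move=> mC; rewrite -[X in measurable X]setTI.
exact: (measurable_fun_pair mX mZ).
Qed.

(** The defining identity of [is_cond_law] covers rectangles only. These form a pi-system generating
    the product sigma-algebra, so Dynkin induction extends it to events tying [Z] to [X], such as a
    threshold that depends on [X]. *)
Lemma cond_law_xsection (Q : probability T R)
    (QE : Q = pushforward P X :> (set T -> \bar R)) :
  forall C : set (T * S), measurable C ->
  P ((fun w => (X w, Z w)) @^-1` C) = (\int[Q]_x k x (xsection C x))%E.
Proof.
have mphi D : measurable D ->
    measurable_fun setT ((fun x => k x (xsection D x)) : T -> \bar R).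
  by move=> mD; apply: measurable_fun_xsection_finite_kernel; rewrite inE.
rewrite measurable_prod_measurableType.
apply: dynkin_induction => /=.
- exact: measurable_prod_measurableType.
- move=> _ _ [A1 mA1 [B1 mB1 <-]] [A2 mA2 [B2 mB2 <-]].
  exists (A1 `&` A2); first exact: measurableI.
  exists (B1 `&` B2); first exact: measurableI.
  by rewrite setXI.
- rewrite preimage_setT probability_setT (eq_integral (cst 1%E)); last first.
    by move=> x _; rewrite xsectionE preimage_setT /= prob_kernel.
  by rewrite integral_cst//= probability_setT mule1.
- move=> _ [B mB [A mA <-]].
  rewrite (_ : _ @^-1` _ = Z @^-1` A `&` X @^-1` B); last first.
    by apply/seteqP; split => w [? ?]; split.
  rewrite Pk// -QE integral_mkcond; apply: eq_integral => x _.
  rewrite patchE; case: ifPn => xB; first by rewrite in_xsectionX.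
  by rewrite notin_xsectionX ?measure0.
- move=> C mC PC.
  have mC' : measurable (~` C) by exact: measurableC.
  rewrite preimage_setC probability_setC; last exact: measurable_ZX.
  (* The constant 1 is integrated as the sum of the masses of the two complementary sections; the
     finite term for [C] then cancels. *)
  rewrite PC -(probability_setT Q) -[Q setT]mul1e -integral_cst//.
  rewrite (eq_integral
    (fun x => k x (xsection C x) + k x (xsection (~` C) x)))%E.
    rewrite ge0_integralD//; [|exact: mphi|exact: mphi].
    rewrite addeAC subee ?add0e// -PC fin_num_measure//.
    exact: measurable_ZX.
  move=> x _; rewrite -measureU.
  + by rewrite !xsectionE -preimage_setU setUv preimage_setT /= prob_kernel.
  + exact: measurable_xsection.
  + exact: measurable_xsection.
  + by rewrite !xsectionE -preimage_setI setICr preimage_set0.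
- move=> F mF tF PF.
  rewrite preimage_bigcup measure_bigcup//=; last 2 first.
  + by move=> n _; exact: measurable_ZX.
  + move/trivIsetP : tF => tF; apply/trivIsetP => i j _ _ ij.
    by rewrite -preimage_setI tF// preimage_set0.
  rewrite (eq_eseriesr (fun n _ => PF n)).
  rewrite (eq_eseriesl (Q := xpredT)); last by move=> n; exact: mem_setT.
  rewrite -integral_nneseries//; last by move=> n; exact: mphi.
  apply: eq_integral => x _.
  rewrite xsection_bigcup measure_bigcup//=.
  + by apply/esym/eq_eseriesl => n; exact: mem_setT.
  + by move=> n _; exact: measurable_xsection.
  + exact: trivIset_xsection.
Qed.

End disintegration.

Section integral_cond_law.
Context {d d' d''} {Omega : measurableType d} {S : measurableType d'}
  {T : measurableType d''} {R : realType}.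
Variable k : R.-pker T ~> S.

(* The kernel from x to the law of (x, z) for z distributed as [k x]. The factor
   [unit] lets [kcomp] compose it with the law of X seen as a constant kernel. *)
Definition ksection (z : unit * T) (C : set (T * S)) : \bar R :=
  k z.2 (xsection C z.2).

Section ksection_measure.
Variable z : unit * T.

Let ksection0 : ksection z set0 = 0%E.
Proof. by rewrite /ksection xsection0. Qed.

Let ksection_ge0 C : (0 <= ksection z C)%E.
Proof. exact: measure_ge0. Qed.

Let ksection_sigma_additive : semi_sigma_additive (ksection z).
Proof.
move=> F mF tF mUF; rewrite /ksection xsection_bigcup.
apply: measure_semi_sigma_additive.
- by move=> n; exact: measurable_xsection.
- exact: trivIset_xsection.
- by rewrite -xsection_bigcup; exact: measurable_xsection.
Qed.

HB.instance Definition _ := isMeasure.Build _ _ _ (ksection z)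
  ksection0 ksection_ge0 ksection_sigma_additive.

End ksection_measure.

Definition mksection (z : unit * T) : {measure set (T * S) -> \bar R} :=
  ksection z.

Let measurable_ksection U :
  measurable U -> measurable_fun [set: unit * T] (mksection ^~ U).
Proof.
move=> mU.
apply: (@measurableT_comp _ _ _ _ _ _ (fun x => k x (xsection U x))) => //.
by apply: measurable_fun_xsection_finite_kernel; rewrite inE.
Qed.

HB.instance Definition _ :=
  isKernel.Build _ _ _ _ _ mksection measurable_ksection.

Let ksection_setT z : mksection z setT = 1%E.
Proof.
by rewrite /mksection/= /ksection xsectionE preimage_setT prob_kernel.
Qed.

HB.instance Definition _ :=
  Kernel_isProbability.Build _ _ _ _ _ mksection ksection_setT.

Variables (P : probability Omega R) (Z : Omega -> S) (X : Omega -> T).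
Hypotheses (mZ : measurable_fun setT Z) (mX : measurable_fun setT X).
Hypothesis Pk : is_cond_law P Z X k.
Variable Q : probability T R.
Hypothesis QE : Q = pushforward P X :> (set T -> \bar R).

(** The joint law of [X] and [Z] is the composition of the law of [X], seen as the constant kernel
    [l], with [mksection]; integration against a composition is iterated integration. *)
Lemma ge0_integral_cond_law (f : T * S -> \bar R) :
  measurable_fun setT f -> (forall z, 0 <= f z)%E ->
  (\int[P]_w f (X w, Z w) = \int[Q]_x \int[k x]_z f (x, z))%E.
Proof.
move=> mf f0.
pose l := kprobability (@measurable_cst _ _ unit _ setT (Q : pprobability T R)).
have mXZ := measurable_fun_pair mX mZ.
transitivity (\int[pushforward P (fun w => (X w, Z w))]_z f z)%E.
  by rewrite ge0_integral_pushforward.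
rewrite (@eq_measure_integral _ _ _ _ (kcomp l mksection tt)); last first.
  move=> C mC _.
  by rewrite /= /pushforward (cond_law_xsection mZ mX Pk QE mC).
rewrite integral_kcomp//; apply: eq_integral => x _ /=.
transitivity (\int[pushforward (k x) (pair x)]_z f z)%E.
  apply: eq_measure_integral => C mC _.
  by rewrite /= /ksection /pushforward xsectionE.
by rewrite ge0_integral_pushforward.
Qed.

Lemma ge0_integral_cond_law_in (B : set T) (f : S -> \bar R) :
  measurable B -> measurable_fun setT f -> (forall z, 0 <= f z)%E ->
  (\int[P]_(w in X @^-1` B) f (Z w) = \int[Q]_(x in B) \int[k x]_z f z)%E.
Proof.
move=> mB mf f0.
pose g := (f \o snd) \_ (fst @^-1` B : set (T * S)).
have mg : measurable_fun setT g.
  apply/(measurable_restrictT _ _).1.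
    by rewrite -[X in measurable X]setTI; exact: measurable_fst.
  by apply: measurable_funTS; exact: measurableT_comp.
have g0 z : (0 <= g z)%E by rewrite /g patchE; case: ifPn => //= _; exact: f0.
have := ge0_integral_cond_law mg g0.
rewrite (integral_mkcond (X @^-1` B)) (integral_mkcond B) => gE.
have gXZ w : g (X w, Z w) = ((fun w => f (Z w)) \_ (X @^-1` B)) w.
  by rewrite /g !patchE.
under eq_integral do rewrite -gXZ.
rewrite gE; apply: eq_integral => x _; rewrite patchE.
case: ifPn => xB.
  by apply: eq_integral => z _; rewrite /g patchE [_ \in _]xB.
rewrite integral0_eq// => z _.
by rewrite /g patchE [_ \in _](negbTE xB).
Qed.

End integral_cond_law.

(** * Conditional CDFs evaluated at a moving threshold *)

Section cond_cdf.
Context {d d'} {Omega : measurableType d} {T : measurableType d'} {R : realType}.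
Variables (P : probability Omega R) (X : Omega -> T).
Hypothesis mX : measurable_fun setT X.

Let measurable_le_cut (B : set T) (tau : T -> R) :
  measurable B -> measurable_fun setT tau ->
  measurable [set z : T * R | B z.1 /\ z.2 <= tau z.1].
Proof.
move=> mB mtau; apply: measurableI.
  by rewrite -[X in measurable X]setTI; exact: measurable_fst.
rewrite -[X in measurable X]setTI.
apply: measurable_fun_le => //.
exact: measurableT_comp.
Qed.

Lemma cond_law_le (Z : Omega -> R) (k : R.-pker T ~> R) (Q : probability T R)
    (B : set T) (tau : T -> R) :
  measurable_fun setT Z -> is_cond_law P Z X k ->
  Q = pushforward P X :> (set T -> \bar R) ->
  measurable B -> measurable_fun setT tau ->
  P [set w | B (X w) /\ Z w <= tau (X w)] =
  (\int[Q]_(x in B) k x `]-oo, tau x]%classic)%E.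
Proof.
move=> mZ Pk QE mB mtau.
have -> : [set w | B (X w) /\ Z w <= tau (X w)] =
  (fun w => (X w, Z w)) @^-1` [set z : T * R | B z.1 /\ z.2 <= tau z.1] by [].
rewrite (cond_law_xsection mZ mX Pk QE (measurable_le_cut mB mtau)).
rewrite [RHS]integral_mkcond; apply: eq_integral => x _; rewrite patchE.
case: ifPn => [/set_mem xB|/negP xB]; rewrite xsectionE.
  congr (k x _); apply/seteqP; split => z /=; rewrite in_itv/=; tauto.
rewrite (_ : _ @^-1` _ = set0) ?measure0//.
by apply/seteqP; split => z //= -[/mem_set].
Qed.

Let measurable_cond_cdf (k : R.-pker T ~> R) (tau : T -> R) :
  measurable_fun setT tau ->
  measurable_fun setT ((fun x => k x `]-oo, tau x]%classic) : T -> \bar R).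
Proof.
move=> mtau.
have := measurable_fun_xsection_finite_kernel k
  (mem_set (measurable_le_cut measurableT mtau)).
congr (measurable_fun _ _); apply/funext => x; congr (k x _).
by rewrite xsectionE; apply/seteqP; split => z /=; rewrite in_itv/=; tauto.
Qed.

Variables (U1 U2 : Omega -> R) (F1 F2 : R.-pker T ~> R).
Hypotheses (mU1 : measurable_fun setT U1) (mU2 : measurable_fun setT U2).
Hypotheses (PF1 : is_cond_law P U1 X F1) (PF2 : is_cond_law P U2 X F2).
Hypothesis F12 : forall x u, F1 x `]-oo, u]%classic = F2 x `]-oo, u]%classic.
Variables (B : set T) (tau1 tau2 : T -> R).
Hypotheses (mB : measurable B) (mtau1 : measurable_fun setT tau1)
  (mtau2 : measurable_fun setT tau2).

Lemma cond_cdf_le : (forall x, B x -> tau1 x <= tau2 x) ->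
  (P [set w | B (X w) /\ (U1 w <= tau1 (X w))%R] <=
   P [set w | B (X w) /\ (U2 w <= tau2 (X w))%R])%E.
Proof.
move=> tau12; have [Q QE] := exists_law P mX.
rewrite (cond_law_le mU1 PF1 QE mB mtau1) (cond_law_le mU2 PF2 QE mB mtau2).
apply: ge0_le_integral => //; try exact/measurable_funTS/measurable_cond_cdf.
move=> x Bx; rewrite F12; apply: le_measure; rewrite ?inE//.
by apply: subset_itvl; rewrite bnd_simp tau12.
Qed.

(** Full support gives positive mass to the gap between the two thresholds, so the integrands differ
    strictly on [B]. Equal integrals then leave a positive function with zero integral, which forces
    [B] to be null. *)
Lemma cond_cdf_lt : (forall x, msupport (F2 x) = setT) ->
  (forall x, B x -> tau1 x < tau2 x) ->
  P [set w | B (X w) /\ (U1 w <= tau1 (X w))%R] =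
  P [set w | B (X w) /\ (U2 w <= tau2 (X w))%R] ->
  P (X @^-1` B) = 0%E.
Proof.
move=> F2supp tau12; have [Q QE] := exists_law P mX.
rewrite (cond_law_le mU1 PF1 QE mB mtau1) (cond_law_le mU2 PF2 QE mB mtau2).
set G1 := fun x => F1 x `]-oo, tau1 x]%classic.
set G2 := fun x => F2 x `]-oo, tau2 x]%classic.
have G1fin x : G1 x \is a fin_num by exact: pker_fin_num.
have G2fin x : G2 x \is a fin_num by exact: pker_fin_num.
have mG1 : measurable_fun setT G1 by exact: measurable_cond_cdf.
have mG2 : measurable_fun setT G2 by exact: measurable_cond_cdf.
have G12 x : B x -> (G1 x < G2 x)%E.
  move=> Bx; rewrite /G1 /G2 F12.
  (* The midpoint witnesses that the open interval between the thresholds meets the support. *)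
  have := F2supp x => /seteqP[_ /(_ ((tau1 x + tau2 x) / 2) I)].
  move=> /(_ `]tau1 x, tau2 x[%classic (itv_open _ _)) /=.
  rewrite in_itv/= !midf_lt ?tau12// => /(_ isT) F2pos.
  apply: (@lt_le_trans _ _
    (F2 x `]-oo, tau1 x]%classic + F2 x `]tau1 x, tau2 x[%classic)%E).
    by rewrite lteDl// pker_fin_num.
  rewrite -measureU//.
    apply: le_measure; rewrite ?inE//; first exact: measurableU.
    move=> z /=; rewrite !in_itv/= => -[/le_trans|/andP[_ /ltW//]].
    by apply; exact/ltW/tau12.
  apply/seteqP; split => z //=; rewrite !in_itv/= => -[h /andP[]].
  by rewrite ltNge h.
pose D x := (G2 x - G1 x)%E.
have mD : measurable_fun setT D by exact: emeasurable_funB.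
have D0 x : B x -> (0 < D x)%E by move=> Bx; rewrite sube_gt0 ?G12.
have DE x : (G2 x = G1 x + D x)%E by rewrite /D addeC subeK.
(* Finiteness allows this integral to be cancelled in the extended reals. *)
have G1int : (\int[Q]_(x in B) G1 x)%E \is a fin_num.
  rewrite ge0_fin_numE ?integral_ge0//.
  apply: (@le_lt_trans _ _ (\int[Q]_(x in B) cst 1 x)%E).
    apply: ge0_le_integral => //; first exact: measurable_funTS.
    by move=> x Bx; exact: pker_le1.
  by rewrite integral_cst// mul1e (le_lt_trans (probability_le1 Q mB))// ltey.
rewrite [X in _ = X](eq_integral (fun x => G1 x + D x)%E); last first.
  by move=> x _; rewrite -DE.
rewrite ge0_integralD//; last 3 first.
- exact: measurable_funTS.
- by move=> x /D0/ltW.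
- exact: measurable_funTS.
move=> G1D; have {}G1D : (\int[Q]_(x in B) D x = 0)%E.
  have := addeK (\int[Q]_(x in B) D x)%E G1int.
  by rewrite (addeC (\int[Q]_(x in B) D x)%E) -G1D subee.
have : (\int[Q]_(x in B) `|D x| = 0)%E.
  rewrite -[RHS]G1D; apply: eq_integral => x /set_mem/D0/ltW D0x.
  by rewrite gee0_abs.
move=> /(ae_eq_integral_abs _ mB (measurable_funTS mD))[N [mN QN BN]].
transitivity (Q B); first by rewrite QE.
apply/eqP; rewrite -measure_le0 -QN; apply: le_measure; rewrite ?inE//.
move=> x Bx; apply: BN => /= /(_ Bx) Dx0.
by have := D0 _ Bx; rewrite Dx0 ltxx.
Qed.

End cond_cdf.

(** * Comparing the two periods *)

Section measurability.
Context {R : realType}.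

Lemma measurable_coord n (i : 'I_n) :
  measurable_fun setT (fun v : 'rV[R]_n => v ord0 i).
Proof.
move=> _ A mA; rewrite setTI; apply: sub_sigma_algebra => /=.
rewrite -bigcup_seq/=; exists i => /=; first by rewrite mem_index_enum.
by exists A => //; rewrite setTI.
Qed.

(** The sigma-algebra on row vectors is generated by the coordinates, so its preimage under [f] is
    generated by the coordinates of [f]. *)
Lemma measurable_fun_rV d (T : measurableType d) n (f : T -> 'rV[R]_n) :
  (forall i, measurable_fun setT (fun x => f x ord0 i)) ->
  measurable_fun setT f.
Proof.
move=> mf; pose c (i : 'I_n) (v : 'rV[R]_n) := v ord0 i.
have sub : g_sigma_preimage (fun i => c i \o f) `<=` @measurable _ T.
  apply: smallest_sub; first exact: sigma_algebra_measurable.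
  rewrite -bigcup_seq/=; apply: bigcup_sub => i _.
  by move=> A [B mB <-]; exact: mf.
move=> _ A mA; apply: sub; rewrite g_sigma_preimage_comp.
by exists A.
Qed.

Lemma measurable_fun_mulmx d (T : measurableType d) n (f : T -> 'rV[R]_n)
    (b : 'cV[R]_n) :
  measurable_fun setT f -> measurable_fun setT (fun x => (f x *m b) ord0 ord0).
Proof.
move=> mf; rewrite (_ : (fun x => _) =
  (fun x => \sum_(j <- index_enum 'I_n) f x ord0 j * b j ord0)).
  apply: measurable_sum => j; apply: measurable_funM => //.
  exact: measurableT_comp (measurable_coord j) mf.
by apply/funext => x; rewrite mxE.
Qed.

Context {K : nat}.

Lemma measurable_at_period d (T : measurableType d) t :
  measurable_fun setT (at_period t : T * T -> T).
Proof. by case: t; [exact: measurable_fst|exact: measurable_snd]. Qed.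

Lemma measurable_Xall : measurable_fun setT (@Xall R K).
Proof. exact: measurableT_comp measurable_snd measurable_fst. Qed.

Lemma measurable_alpha : measurable_fun setT (@alpha R K).
Proof. exact: measurableT_comp measurable_fst measurable_fst. Qed.

Lemma measurable_alphaX : measurable_fun setT (@alphaX R K).
Proof.
by apply: measurable_fun_pair; [exact: measurable_alpha|exact: measurable_Xall].
Qed.

Lemma measurable_U t : measurable_fun setT (@U R K t).
Proof. exact: measurableT_comp (measurable_at_period t) measurable_snd. Qed.

Lemma measurable_dX : measurable_fun setT (@dX R K).
Proof.
apply: measurable_fun_rV => i.
rewrite (_ : (fun w => _) =
  (fun w => X t2 w ord0 i) \- (fun w => X t1 w ord0 i)).
  apply: measurable_funB; apply: measurableT_comp (measurable_coord i) _;
  exact: measurableT_comp (measurable_at_period _) measurable_Xall.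
by apply/funext => w; rewrite !mxE.
Qed.

Lemma measurable_W : measurable_fun setT (@W R K).
Proof.
apply: measurable_fun_rV => i; rewrite -[i]splitK; case: (fintype.split i) => j.
  rewrite (_ : (fun w => _) = (fun w => dX w ord0 j)).
    exact: measurableT_comp (measurable_coord j) measurable_dX.
  by apply/funext => w; rewrite /W row_mxEl.
rewrite (_ : (fun w => _) = cst (-1)); first exact: measurable_cst.
by apply/funext => w; rewrite /W row_mxEr mxE.
Qed.

End measurability.

Section thresholds.
Context {R : realType} {K : nat}.
Implicit Types s : structure R K.

Definition xbeta s t (x : covariates R K) : R :=
  (at_period t x *m beta s) ord0 ord0.

Lemma measurable_xbeta s t : measurable_fun setT (xbeta s t).
Proof. exact: measurable_fun_mulmx (measurable_at_period t). Qed.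

Lemma same_observables_X s s' B : same_observables s s' -> measurable B ->
  joint s (Xall @^-1` B) = joint s' (Xall @^-1` B).
Proof.
move=> ss' mB.
have := ss' (snd @^-1` B); apply.
by rewrite -[X in measurable X]setTI; exact: measurable_snd.
Qed.

Lemma same_observables_ge s s' t y (B : set (covariates R K)) :
  same_observables s s' -> measurable B ->
  joint s [set w | B (Xall w) /\ y <= Y s t w] =
  joint s' [set w | B (Xall w) /\ y <= Y s' t w].
Proof.
move=> ss' mB.
pose C := [set o : (R * R) * covariates R K | B o.2 /\ y <= at_period t o.1].
have mC : measurable C.
  apply: measurableI.
    by rewrite -[X in measurable X]setTI; exact: measurable_snd.
  rewrite -[X in measurable X]setTI; apply: measurable_fun_le => //.
  exact: measurableT_comp (measurable_at_period t) measurable_fst.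
have CE s0 : [set w | B (Xall w) /\ y <= Y s0 t w] = observables s0 @^-1` C.
  by apply/seteqP; split => w; rewrite /C /observables/=; case: (t).
by rewrite !CE; exact: ss'.
Qed.

Lemma strict_le_mono s t : A4a s ->
  {mono trans s t : x y / x <= y}.
Proof. by move=> /(_ t); exact: le_mono. Qed.

Let cut s t (z : R) (p : R * covariates R K) := p.1 + xbeta s t p.2 - z.

Let measurable_cut s t z : measurable_fun setT (cut s t z).
Proof.
apply: measurable_funB => //; apply: measurable_funD => //.
exact: measurableT_comp (measurable_xbeta s t) measurable_snd.
Qed.

Let cutE s t z (B : set (covariates R K)) : A4a s ->
  [set w | B (Xall w) /\ trans s t z <= Y s t w] =
  [set w | (snd @^-1` B) (alphaX w) /\ U t w <= cut s t z (alphaX w)].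
Proof.
move=> sA4a; apply/seteqP; split => w /= [Bw]; rewrite /Y strict_le_mono//;
  rewrite /cut /xbeta /Xbeta /X /= => ?; split => //; lra.
Qed.

(** On [B] the structure [s] orders the probabilities of reaching the two outcome levels one way and
    [s'] orders them the other way. They are observable, hence equal, and the strict inequality in
    [s] makes [B] null. *)
Lemma thresholds_null s s' t u (z z' : period -> R) (B : set (covariates R K)) :
  A2 s -> A2 s' -> A4a s -> A4a s' -> same_observables s s' ->
  (forall t, trans s t (z t) = trans s' t (z' t)) ->
  measurable B ->
  (forall x, B x -> xbeta s t x - z t < xbeta s u x - z u) ->
  (forall x, B x -> xbeta s' u x - z' u <= xbeta s' t x - z' t) ->
  joint s (Xall @^-1` B) = 0%E.
Proof.
move=> [F [PF F12 Fsupp]] [F' [PF' F12' _]] sA4a s'A4a ss' zz' mB Bs Bs'.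
(* Stated for any pair of periods, so that [t] and [u] may be taken in either order. *)
have Ftu t0 u0 x v : F t0 x `]-oo, v]%classic = F u0 x `]-oo, v]%classic.
  by case: t0; case: u0.
have Ftu' t0 u0 x v : F' t0 x `]-oo, v]%classic = F' u0 x `]-oo, v]%classic.
  by case: t0; case: u0.
have mB2 : measurable (snd @^-1` B : set (R * covariates R K)).
  by rewrite -[X in measurable X]setTI; exact: measurable_snd.
have le_s : (joint s [set w | B (Xall w) /\ (trans s t (z t) <= Y s t w)%R] <=
             joint s [set w | B (Xall w) /\ (trans s u (z u) <= Y s u w)%R])%E.
  rewrite !cutE//; apply: (cond_cdf_le measurable_alphaX (measurable_U t)
    (measurable_U u) (PF t) (PF u) (Ftu t u) mB2
    (measurable_cut s t (z t)) (measurable_cut s u (z u))).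
  by move=> x /= /Bs; rewrite /cut; lra.
have le_s' : (joint s' [set w | B (Xall w) /\ (trans s' u (z' u) <= Y s' u w)%R] <=
             joint s' [set w | B (Xall w) /\ (trans s' t (z' t) <= Y s' t w)%R])%E.
  rewrite !cutE//; apply: (cond_cdf_le measurable_alphaX (measurable_U u)
    (measurable_U t) (PF' u) (PF' t) (Ftu' u t) mB2
    (measurable_cut s' u (z' u)) (measurable_cut s' t (z' t))).
  by move=> x /= /Bs'; rewrite /cut; lra.
rewrite -!zz' -!(same_observables_ge _ _ ss' mB) in le_s'.
apply: (cond_cdf_lt measurable_alphaX (measurable_U t) (measurable_U u)
  (PF t) (PF u) (Ftu t u) mB2 (measurable_cut s t (z t))
  (measurable_cut s u (z u)) (Fsupp u)).
- by move=> x /= /Bs; rewrite /cut; lra.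
- by rewrite -!cutE//; apply/eqP; rewrite eq_le le_s le_s'.
Qed.

End thresholds.

(** * Consequences of the support conditions *)

(** In the variable e = v * b + c the second function reads e * m + l. The sign conditions at e and
    -e give |l| <= e * m for every e > 0, which forces m >= 0 and l = 0. *)
Lemma affine_sign_agree {R : realFieldType} (b c b' c' : R) : b != 0 ->
  (forall v, 0 < v * b + c -> 0 <= v * b' + c') ->
  (forall v, v * b + c < 0 -> v * b' + c' <= 0) ->
  b' * c = b * c' /\ 0 <= b * b'.
Proof.
move=> b0 pos neg.
pose m := b' / b; pose l := c' - c * m.
have mb : m * b = b' by rewrite divfK.
have vE e : (e - c) / b * b' + c' = e * m + l.
  by rewrite /l /m; field.
have vb e : (e - c) / b * b + c = e by rewrite divfK// subrK.
have ml e : 0 < e -> - (e * m) <= l <= e * m.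
  move=> e0; have := pos ((e - c) / b); have := neg ((- e - c) / b).
  by rewrite !vb !vE oppr_lt0 => /(_ e0) + /(_ e0); rewrite mulNr; lra.
have m0 : 0 <= m by have := ml _ ltr01; rewrite mul1r; lra.
have l0 : l = 0.
  apply/eqP; rewrite -normr_eq0; apply/eqP.
  apply: le_anti; rewrite normr_ge0 andbT.
  apply/ler_addgt0Pl => e e0; rewrite addr0.
  have m1 : 0 < m + 1 by lra.
  (* The denominator m + 1 stays positive even when m = 0 and keeps the product with m below e. *)
  have /andP[] := ml (e / (m + 1)) (divr_gt0 e0 m1).
  have em : e / (m + 1) * m <= e.
    by rewrite mulrAC ler_pdivrMr//; nra.
  by move=> ? ?; rewrite ler_norml; apply/andP; split; lra.
split; last by rewrite -mb; have := sqr_ge0 b; nra.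
have /eqP := l0; rewrite /l subr_eq0 => /eqP ->.
by rewrite -mb; ring.
Qed.

Lemma affine_continuous {R : realType} (b c : R) :
  continuous (fun v : R => v * b + c).
Proof.
move=> v; apply: cvgD; last exact: cvg_cst.
by apply: cvgM; [exact: cvg_id|exact: cvg_cst].
Qed.

(** A zero integral of a positive function puts [A] inside a Lebesgue null set, while a nonempty
    open set contains an interval of positive length. *)
Lemma pos_density_open_null {R : realType} (f : R -> R) (A : set R) :
  measurable_fun setT f -> (forall v, 0 < f v) -> open A -> measurable A ->
  (\int[lebesgue_measure]_(v in A) (f v)%:E)%E = 0%E -> A = set0.
Proof.
move=> mf f0 oA mA intA0.
have : (\int[lebesgue_measure]_(v in A) `|(f v)%:E|)%E = 0%E.
  rewrite -[RHS]intA0; apply: eq_integral => v _.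
  by rewrite gee0_abs// lee_fin ltW.
have mfA : measurable_fun A (fun v => (f v)%:E).
  by apply/measurable_EFinP; exact: measurable_funTS.
move=> /(ae_eq_integral_abs (@lebesgue_measure R) mA mfA)[N [mN N0 AN]].
apply/seteqP; split => // v Av.
have /nbhs_ballP[e /= e0 ballA] : nbhs v A by apply: open_nbhs_nbhs.
have : (lebesgue_measure `](v - e)%R, (v + e)%R[%classic <=
        lebesgue_measure N)%E.
  apply: le_measure; rewrite ?inE// => x xve; apply: AN => /= H.
  have Ax : A x by apply: ballA; rewrite ball_itv.
  by have := f0 x; have [->] := H Ax; rewrite ltxx.
rewrite N0 lebesgue_measure_itv/= lte_fin.
by case: ifPn => [_|]; rewrite ?lee_fin; lra.
Qed.

Section density.
Context {R : realType}.

Lemma ae_joint {d d'} {Omega : measurableType d} {T : measurableType d'}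
    (P : probability Omega R) (X : Omega -> T) (mX : measurable_fun setT X)
    (A : T -> Prop) :
  {ae pushforward P X, forall x, A x} -> {ae P, forall w, A (X w)}.
Proof.
move=> [N [mN N0 AN]]; exists (X @^-1` N); split => //.
  by rewrite -[X in measurable X]setTI; exact: mX.
by move=> w /= Aw; exact: AN.
Qed.

Lemma cond_law_null {d d' d''} {Omega : measurableType d} {S : measurableType d'}
    {T : measurableType d''} (P : probability Omega R) (Z : Omega -> S)
    (X : Omega -> T) (k : R.-pker T ~> S) (C : set (T * S)) :
  measurable_fun setT Z -> measurable_fun setT X -> is_cond_law P Z X k ->
  measurable C -> P [set w | C (X w, Z w)] = 0%E ->
  {ae pushforward P X, forall x, k x (xsection C x) = 0%E}.
Proof.
move=> mZ mX Pk mC PC0; have [Q QE] := exists_law P mX; rewrite -QE.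
have mk : measurable_fun setT ((fun x => k x (xsection C x)) : T -> \bar R).
  by apply: measurable_fun_xsection_finite_kernel; rewrite inE.
have : (\int[Q]_x `|k x (xsection C x)|)%E = 0%E.
  rewrite -[RHS]PC0 [RHS](cond_law_xsection mZ mX Pk QE mC).
  by apply: eq_integral => x _; rewrite gee0_abs.
move=> /(ae_eq_integral_abs Q measurableT mk).
by apply: filterS => x /(_ I).
Qed.

Lemma probability_ae_ex {d} {Omega : measurableType d} (P : probability Omega R)
    (A : Omega -> Prop) : {ae P, forall w, A w} -> exists w, A w.
Proof.
move=> [N [mN N0 AN]]; apply: contrapT => /forallNP nA.
have NT : N = setT by apply/seteqP; split => // w _; apply: AN; exact: nA.
by move: N0; rewrite NT probability_setT => /eqP; rewrite onee_eq0.
Qed.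

Lemma mulmx_col' n (v : 'rV[R]_n.+1) (b : 'cV[R]_n.+1) k :
  (v *m b) ord0 ord0 =
  v ord0 k * b k ord0 + (col' k v *m row' k b) ord0 ord0.
Proof.
rewrite !mxE (bigD1_ord k)//=; congr (_ + _).
by apply: eq_bigr => j _; rewrite !mxE.
Qed.

(** With the other components of [dX] frozen, both functions are affine in the k-th one. The sets
    where their signs clash have null sections almost surely; these are open, hence empty under a
    positive density, and [affine_sign_agree] applies. *)
Lemma A3i_affine K (s : structure R K) : A3i s ->
  exists k, beta s k ord0 != 0 /\ forall (b' : 'cV[R]_K) (c c' : R),
    joint s [set w | c < (dX w *m beta s) ord0 ord0 /\
                     (dX w *m b') ord0 ord0 < c'] = 0%E ->
    joint s [set w | (dX w *m beta s) ord0 ord0 < c /\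
                     c' < (dX w *m b') ord0 ord0] = 0%E ->
    {ae joint s, forall w,
      b' k ord0 * ((dX w *m beta s) ord0 ord0 - c) =
      beta s k ord0 * ((dX w *m b') ord0 ord0 - c') /\
      0 <= beta s k ord0 * b' k ord0}.
Proof.
case: K s => [|K] s [k]; first by case: k.
move=> [/eqP bk [L [PL Ldens]]]; exists k; split => // b' c c' N1 N2.
set b := beta s in bk N1 N2 *.
set V := fun w => dX w ord0 k in PL.
set X := fun w => col' k (dX w) in PL Ldens.
have mV : measurable_fun setT V.
  exact: measurableT_comp (measurable_coord k) measurable_dX.
have mX : measurable_fun setT X.
  apply: measurable_fun_rV => j; rewrite (_ : (fun w => _) =
    (fun w => dX w ord0 (lift k j))).
    exact: measurableT_comp (measurable_coord (lift k j)) measurable_dX.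
  by apply/funext => w; rewrite mxE.
(* The index [dX b - c] as a function of the other components and of the k-th one; [C1] and [C2] are
   the two kinds of sign clash. *)
pose a (b : 'cV[R]_K.+1) c (z : 'rV[R]_K * R) :=
  z.2 * b k ord0 + ((z.1 *m row' k b) ord0 ord0 - c).
have ma b0 c0 : measurable_fun setT (a b0 c0).
  apply: measurable_funD; first exact: measurable_funM.
  apply: measurable_funB => //.
  exact: measurable_fun_mulmx measurable_fst.
have aE b0 c0 w : a b0 c0 (X w, V w) = (dX w *m b0) ord0 ord0 - c0.
  by rewrite /a /= [in RHS](mulmx_col' _ _ k) addrA.
pose C1 := [set z | 0 < a b c z /\ a b' c' z < 0].
pose C2 := [set z | a b c z < 0 /\ 0 < a b' c' z].
have ma_gt0 b0 c0 : measurable [set z | 0 < a b0 c0 z].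
  rewrite (_ : mkset _ = setT `&` a b0 c0 @^-1` `]0, +oo[%classic); last first.
    by rewrite setTI; apply/seteqP; split => z; rewrite /= in_itv/= andbT.
  exact: ma.
have ma_lt0 b0 c0 : measurable [set z | a b0 c0 z < 0].
  rewrite (_ : mkset _ = setT `&` a b0 c0 @^-1` `]-oo, 0[%classic); last first.
    by rewrite setTI; apply/seteqP; split => z /=; rewrite in_itv/=.
  exact: ma.
have mC1 : measurable C1 by exact: measurableI (ma_gt0 b c) (ma_lt0 b' c').
have mC2 : measurable C2 by exact: measurableI (ma_lt0 b c) (ma_gt0 b' c').
have PC1 : joint s [set w | C1 (X w, V w)] = 0%E.
  rewrite -[RHS]N1; congr (joint s _); apply/seteqP.
  by split => w; rewrite /C1/= !aE subr_gt0 subr_lt0.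
have PC2 : joint s [set w | C2 (X w, V w)] = 0%E.
  rewrite -[RHS]N2; congr (joint s _); apply/seteqP.
  by split => w; rewrite /C2/= !aE subr_gt0 subr_lt0.
have ae1 := ae_joint mX (cond_law_null mV mX PL mC1 PC1).
have ae2 := ae_joint mX (cond_law_null mV mX PL mC2 PC2).
have aeL := ae_joint mX Ldens.
apply: filterS (filterI ae1 (filterI ae2 aeL)) => w [L1 [L2 [f [mf f0 LE]]]].
have oa b0 c0 : continuous (fun v => a b0 c0 (X w, v)).
  have := @affine_continuous R (b0 k ord0) ((X w *m row' k b0) ord0 ord0 - c0).
  exact.
have open1 : open (xsection C1 (X w)).
  rewrite xsectionE; apply: openI.
    by have /continuousP := oa b c => /(_ _ (@open_gt _ 0)).
  by have /continuousP := oa b' c' => /(_ _ (@open_lt _ 0)).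
have open2 : open (xsection C2 (X w)).
  rewrite xsectionE; apply: openI.
    by have /continuousP := oa b c => /(_ _ (@open_lt _ 0)).
  by have /continuousP := oa b' c' => /(_ _ (@open_gt _ 0)).
have mx1 : measurable (xsection C1 (X w)) by exact: measurable_xsection.
have mx2 : measurable (xsection C2 (X w)) by exact: measurable_xsection.
rewrite LE// in L1; rewrite LE// in L2.
have /seteqP[E1 _] := pos_density_open_null mf f0 open1 mx1 L1.
have /seteqP[E2 _] := pos_density_open_null mf f0 open2 mx2 L2.
have [||eq1 bb] := @affine_sign_agree _ (b k ord0)
  ((X w *m row' k b) ord0 ord0 - c) (b' k ord0)
  ((X w *m row' k b') ord0 ord0 - c') bk.
- move=> v v0; rewrite leNgt; apply/negP => v1.
  by apply: (E1 v); apply/xsectionP; split.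
- move=> v v0; rewrite leNgt; apply/negP => v1.
  by apply: (E2 v); apply/xsectionP; split.
split => //; rewrite -!aE /a/= mulrDr [RHS]mulrDr eq1; congr (_ + _); ring.
Qed.

End density.

(** * Identification of the coefficients and of the transformations *)

Section identification.
Context {R : realType} {K : nat}.
Implicit Types s : structure R K.

Lemma continuous_mulmx n (b : 'cV[R]_n) :
  continuous (fun v : 'rV[R]_n => (v *m b) ord0 ord0).
Proof.
rewrite (_ : (fun v => _) = 
    (fun v : 'rV[R]_n => \sum_(j <- index_enum 'I_n) v ord0 j * b j ord0)).
  elim: (index_enum _) => [|j r IHr].
    rewrite (_ : (fun v => _) = cst 0); last first.
      by apply/funext => v; rewrite big_nil.
    exact: cst_continuous.
  rewrite (_ : (fun v => _) = (fun v : 'rV[R]_n =>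
      v ord0 j * b j ord0 + \sum_(i <- r) v ord0 i * b i ord0)); last first.
    by apply/funext => v; rewrite big_cons.
  move=> v; have FF : Filter (nbhs v) by exact: nbhs_filter.
  apply: cvgD; last exact: IHr.
  by apply: cvgM; [exact: coord_continuous|exact: cvg_cst].
by apply/funext => v; rewrite mxE.
Qed.

(** For b nonzero the kernel of v |-> v b is a proper subspace. Its complement is open and carries
    no mass of [W], so the support of [W] would lie in that kernel. *)
Lemma A3ii_orthogonal s (b : 'cV[R]_(K + 1)) : A3ii s ->
  {ae joint s, forall w, (W w *m b) ord0 ord0 = 0} -> b = 0.
Proof.
move=> sA3ii bW.
pose V := lker (linfun (mulmxr b : 'rV[R]_(K + 1) -> 'rV[R]_1)).
have VE v : (v \in V) = ((v *m b) ord0 ord0 == 0).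
  rewrite memv_ker lfunE /=; apply/eqP/eqP => [->|vb0]; first by rewrite mxE.
  by apply/matrixP => i j; rewrite !ord1 vb0 mxE.
apply: contrapT => b0; apply: (sA3ii V) => [VT|v /= vsupp].
  apply: b0; apply/matrixP => i j; rewrite !ord1 mxE.
  have : delta_mx ord0 i \in V by rewrite VT memvf.
  by rewrite VE -rowE mxE => /eqP.
apply/negPn/negP => vV.
(* The nonzero reals as a union of open half-lines, so that [N] is the open complement of the
   kernel. *)
pose S := [set r : R | r < 0] `|` [set r | 0 < r].
have oS : open S by apply: openU; [exact: open_lt|exact: open_gt].
have SE r : S r <-> r != 0.
  rewrite neq_lt; split => [[]/= ->|/orP[]]; rewrite ?orbT//; by [left|right].
pose N := (fun v : 'rV[R]_(K + 1) => (v *m b) ord0 ord0) @^-1` S.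
have oN : open N by have /continuousP := @continuous_mulmx _ b; exact.
have Nv : N v by apply/SE; rewrite -VE.
have := vsupp N oN Nv; case: bW => A [mA A0 bWA].
rewrite /pushforward (@measure_negligible _ _ _ _ (W @^-1` N)) ?ltxx//.
  have mN : measurable N.
    rewrite -[X in measurable X]setTI.
    exact: (measurable_fun_mulmx b (@measurable_id _ _ setT) measurableT
      (open_measurable oS)).
  by rewrite -[X in measurable X]setTI; exact: measurable_W.
by exists A; split => // w /SE/eqP Nw; exact: bWA.
Qed.

Lemma eucl_norm1 n (b : 'cV[R]_n) :
  eucl_norm b = 1 -> \sum_(i < n) b i ord0 ^+ 2 = 1.
Proof.
move=> b1; have s0 : 0 <= \sum_(i < n) b i ord0 ^+ 2.
  by apply: sumr_ge0 => i _; exact: sqr_ge0.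
by rewrite -(sqr_sqrtr s0) -/(eucl_norm b) b1 expr1n.
Qed.

Lemma dX_mulmx (b : 'cV[R]_K) (w : outcomes R K) :
  (dX w *m b) ord0 ord0 =
  (X t2 w *m b) ord0 ord0 - (X t1 w *m b) ord0 ord0.
Proof. by rewrite /dX mulmxBl !mxE. Qed.

(** [z] and [z'] are latent values reaching common outcome levels. Null sign clashes make the
    extended coefficient vectors proportional; the unit norms fix the factor up to sign, and the
    sign comes from [A3i_affine]. *)
Lemma identified_beta s s' (z z' : period -> R) :
  A2 s -> A2 s' -> A3i s -> A3ii s -> A4a s -> A4a s' ->
  eucl_norm (beta s) = 1 -> eucl_norm (beta s') = 1 -> same_observables s s' ->
  (forall t, trans s t (z t) = trans s' t (z' t)) ->
  beta s = beta s' /\ z t2 - z t1 = z' t2 - z' t1.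
Proof.
move=> sA2 s'A2 sA3i sA3ii sA4a s'A4a b1 b'1 ss' zz'.
have [k [bk sgn]] := A3i_affine sA3i.
set b := beta s in bk b1 sgn *; set b' := beta s' in b'1 *.
pose c := z t2 - z t1; pose c' := z' t2 - z' t1.
have mB s0 s1 t u (a0 a1 : R) : measurable
    [set x : covariates R K | xbeta s0 t x - xbeta s0 u x < a0 /\
                              xbeta s1 u x - xbeta s1 t x < a1].
  have mlt s2 t0 u0 (a : R) :
      measurable [set x : covariates R K | xbeta s2 t0 x - xbeta s2 u0 x < a].
    rewrite (_ : mkset _ = setT `&`
        (xbeta s2 t0 \- xbeta s2 u0) @^-1` `]-oo, a[%classic); last first.
      by rewrite setTI; apply/seteqP; split => x; rewrite /= in_itv/=.
    by apply: measurable_funB => //; exact: measurable_xbeta.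
  exact: measurableI (mlt s0 t u a0) (mlt s1 u t a1).
(* Both orders of the two periods are used below, one for each kind of clash. *)
have null t u : joint s (Xall @^-1` [set x : covariates R K |
    xbeta s t x - xbeta s u x < z t - z u /\
    xbeta s' u x - xbeta s' t x < z' u - z' t]) = 0%E.
  apply: (thresholds_null (t := t) (u := u) sA2 s'A2 sA4a s'A4a ss' zz'
    (mB s s' t u _ _)).
    by move=> x [+ _]; lra.
  by move=> x [_ +]; lra.
have := sgn b' c c'.
rewrite (_ : [set w | c < _ /\ _] = Xall @^-1` [set x : covariates R K |
    xbeta s t1 x - xbeta s t2 x < z t1 - z t2 /\
    xbeta s' t2 x - xbeta s' t1 x < z' t2 - z' t1]); last first.
  apply/seteqP; split => w /=; rewrite !dX_mulmx /xbeta /c /c' /X /=;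
    by move=> [? ?]; split; lra.
rewrite (_ : [set w | _ < c /\ _] = Xall @^-1` [set x : covariates R K |
    xbeta s t2 x - xbeta s t1 x < z t2 - z t1 /\
    xbeta s' t1 x - xbeta s' t2 x < z' t1 - z' t2]); last first.
  apply/seteqP; split => w /=; rewrite !dX_mulmx /xbeta /c /c' /X /=;
    by move=> [? ?]; split; lra.
move=> /(_ (null _ _) (null _ _)) aff.
(* The sign relation does not depend on the outcome, so a single one suffices. *)
have [_ [_ bb']] := probability_ae_ex aff.
set p := b k ord0 in bk aff bb'; set p' := b' k ord0 in aff bb'.
(* Chosen so that W d = p' (dX b - c) - p (dX b' - c'), which vanishes almost surely by [aff]. *)
pose d : 'cV[R]_(K + 1) :=
  col_mx (p' *: b - p *: b') (const_mx (p' * c - p * c')).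
have d0 : d = 0.
  apply: (A3ii_orthogonal sA3ii); apply: filterS aff => w [affw _].
  rewrite /W /d mul_row_col mulmxBr -!scalemxAr.
  rewrite !mxE big_ord1 !mxE in affw *.
  lra.
have [db dc] : p' *: b = p *: b' /\ p' * c = p * c'.
  move/eqP: d0; rewrite col_mx_eq0 subr_eq0 => /andP[/eqP -> /eqP].
  move=> /matrixP/(_ ord0 ord0); rewrite !mxE => /eqP.
  by rewrite subr_eq0 => /eqP.
have pp' : p' ^+ 2 = p ^+ 2.
  rewrite -[LHS]mulr1 -[RHS]mulr1 -{1}(eucl_norm1 b1) -(eucl_norm1 b'1).
  rewrite !mulr_sumr; apply: eq_bigr => i _.
  by rewrite -!exprMn; have := congr1 (fun v : 'cV[R]_K => v i ord0) db;
    rewrite !mxE => ->.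
have {pp'} pE : p' = p.
  have /eqP := pp'; rewrite eqf_sqr => /orP[/eqP //|/eqP p'N].
  (* If p' = -p, then p p' = -p^2 < 0, against [bb']. *)
  have p0 : 0 < p ^+ 2 by rewrite exprn_even_gt0.
  by move: bb'; rewrite p'N; lra.
rewrite pE in db dc; split; first exact: (scalerI bk).
exact: (mulfI bk).
Qed.

(** The ranges coincide, so some y gives in [s'] the outcome that z + z0 gives in [s]. The
    identified shift between the periods then leaves only y = z + z0'. *)
Lemma identified_trans (Ysupp : set R) s s' :
  A1 Ysupp s -> A1 Ysupp s' ->
  (forall z z' : period -> R, (forall t, trans s t (z t) = trans s' t (z' t)) ->
     z t2 - z t1 = z' t2 - z' t1) ->
  forall y0 z0 z0', trans s t1 z0 = y0 -> trans s' t1 z0' = y0 ->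
  forall z, trans s t2 (z + z0) = trans s' t2 (z + z0').
Proof.
move=> sA1 s'A1 shift y0 z0 z0' z0E z0'E z.
have [rs _ _ _] := sA1 t2; have [rs' _ _ _] := s'A1 t2.
have : range (trans s' t2) (trans s t2 (z + z0)).
  by rewrite rs' -rs; exists (z + z0).
move=> [y _ yE].
have := shift (fun t => if t is t1 then z0 else z + z0)
  (fun t => if t is t1 then z0' else y).
rewrite -yE => H; congr (trans s' t2 _).
have : z + z0 - z0 = y - z0'; last lra.
by apply: H => -[] //; rewrite z0E z0'E.
Qed.

Lemma hinvK s t z : A4a s -> hinv s t (trans s t z) = z.
Proof.
move=> sA4a; apply: pinvKV; rewrite ?inE//.
by move=> x y _ _; exact: (inc_inj (strict_le_mono t sA4a)).
Qed.

End identification.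

(** * A measurable inverse of an increasing function *)

Section monotone_inverse.
Context {R : realType}.

(* Unlike the pseudo-inverse [hinv], this left inverse of [h] is measurable
   even before the range of [h] is known to be Borel. *)
Definition lower_inv (h : R -> R) (y : R) : R :=
  fine (ereal_inf [set z%:E | z in [set z | y <= h z]]).

Lemma lower_invK (h : R -> R) (z : R) : {mono h : x y / x <= y} ->
  lower_inv h (h z) = z.
Proof.
move=> mh; rewrite /lower_inv (_ : ereal_inf _ = z%:E)//.
apply/le_anti/andP; split; first by apply: ereal_inf_lbound; exists z => /=.
by apply: le_ereal_inf_tmp => _ [x /= + <-]; rewrite mh lee_fin.
Qed.

(** The extended-real infimum is monotone in y, so preimages of rays are intervals. *)
Lemma measurable_lower_inv (h : R -> R) : measurable_fun setT (lower_inv h).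
Proof.
set e := fun y => ereal_inf [set z%:E | z in [set z | y <= h z]].
have e_homo : {homo e : x y / x <= y >-> (x <= y)%E}.
  move=> x y xy; apply: ereal_inf_le_tmp => _ [z /= yz <-]; exists z => //=.
  exact: le_trans yz.
suff me : measurable_fun setT e by exact: measurableT_comp me.
apply: (measurability _ (ErealGenInftyO.measurableE R)) => _ /= -[_ [r ->] <-].
rewrite setTI; apply: is_interval_measurable => x y /= _ yr z /andP[_ zy].
move: yr; rewrite !in_itv/=; apply: le_lt_trans; exact: e_homo.
Qed.

End monotone_inverse.

(** * Conditional means of non-integrable variables *)

Section local_cond_mean.
Local Open Scope ereal_scope.
Context {d d'} {Omega : measurableType d} {T : measurableType d'} {R : realType}.

(* [Z] need not be integrable: [b] stands for its conditional first absolute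
   moment, and [Z] is integrable on the events where [b] is bounded, which
   exhaust the space up to a null set. *)
Definition local_cond_mean (P : probability Omega R) (Q : probability T R)
    (Z : Omega -> R) (X : Omega -> T) (m : T -> R) (b : T -> \bar R) :=
  [/\ measurable_fun setT Z /\ measurable_fun setT m,
      measurable_fun setT b, forall x, 0 <= b x, {ae Q, forall x, b x < +oo} &
      forall (r : R) C, measurable C -> (forall x, C x -> b x <= r%:E) ->
        [/\ P.-integrable (X @^-1` C) (EFin \o Z),
            Q.-integrable C (EFin \o m) &
            \int[P]_(w in X @^-1` C) (Z w)%:E = \int[Q]_(x in C) (m x)%:E]].

(** A version [m] is constrained only almost everywhere and may fail to be measurable. It is
    replaced by [m0], built from the kernel integrals of the positive and negative parts; the bound
    is the kernel integral of the absolute value. *)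
Lemma cond_mean_local (P : probability Omega R) (Q : probability T R)
    (Z : Omega -> R) (X : Omega -> T) (m : T -> R) :
  measurable_fun setT Z -> measurable_fun setT X ->
  Q = pushforward P X :> (set T -> \bar R) ->
  is_cond_mean P Z X m ->
  exists m0 b, local_cond_mean P Q Z X m0 b /\ {ae Q, forall x, m0 x = m x}.
Proof.
move=> mZ mX QE [k [Pk km]]; rewrite -QE in km.
pose f : R -> \bar R := EFin.
have mf : measurable_fun setT f by apply/measurable_EFinP; exact: measurable_id.
have mint (g : R -> \bar R) : measurable_fun setT g -> (forall z, 0 <= g z) ->
    measurable_fun setT (fun x => \int[k x]_z g z).
  move=> mg g0.
  apply: (measurable_fun_integral_finite_kernel (g \o snd)) => //=.
  exact: measurableT_comp.
have mabs : measurable_fun setT (abse \o f) by exact: measurableT_comp.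
have mp : measurable_fun setT f^\+ by exact: measurable_funepos.
have mn : measurable_fun setT f^\- by exact: measurable_funeneg.
pose a x := \int[k x]_z `|f z|.
pose p x := \int[k x]_z f^\+ z.
pose n x := \int[k x]_z f^\- z.
have ma : measurable_fun setT a by exact: mint.
have mpx : measurable_fun setT p by exact: mint.
have mnx : measurable_fun setT n by exact: mint.
have pa x : p x <= a x.
  apply: ge0_le_integral => // z _; rewrite -/((abse \o f) z) fune_abse.
  by rewrite leeDl.
have na x : n x <= a x.
  apply: ge0_le_integral => // z _; rewrite -/((abse \o f) z) fune_abse.
  by rewrite leeDr.
have p0 x : 0 <= p x by exact: integral_ge0.
have n0 x : 0 <= n x by exact: integral_ge0.
(* [fine] sends infinite values to 0; [m0] is the kernel mean only where [a] is finite, which is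
   almost everywhere. *)
pose m0 x := (fine (p x) - fine (n x))%R.
have m0E x : a x < +oo -> (m0 x)%:E = p x - n x.
  move=> ax; rewrite EFinB !fineK//.
    by rewrite ge0_fin_numE// (le_lt_trans (na x)).
  by rewrite ge0_fin_numE// (le_lt_trans (pa x)).
exists m0, a; split.
  split => //.
  - split => //; apply: measurable_funB; exact: measurableT_comp.
  - by move=> x; exact: integral_ge0.
  - apply: filterS km => x [/integrableP[_]] //.
  move=> r C mC Cr.
  have mXC : measurable (X @^-1` C).
    by rewrite -[Y in measurable Y]setTI; exact: mX.
  have int (g : R -> \bar R) : measurable_fun setT g -> (forall z, 0 <= g z) ->
      \int[P]_(w in X @^-1` C) g (Z w) = \int[Q]_(x in C) \int[k x]_z g z.
    by move=> mg g0; exact: (ge0_integral_cond_law_in mZ mX Pk QE mC).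
  have mfZ : measurable_fun setT (EFin \o Z) by exact: measurableT_comp.
  have intC : \int[Q]_(x in C) a x < +oo.
    apply: (@le_lt_trans _ _ (\int[Q]_(x in C) (cst r%:E) x)).
      apply: ge0_le_integral => //; first by move=> x _; exact: integral_ge0.
      exact: measurable_funTS.
    by rewrite integral_cst// ltey_eq fin_numM ?orbT// fin_num_measure.
  have iZ : P.-integrable (X @^-1` C) (EFin \o Z).
    apply/integrableP; split; first exact: measurable_funTS.
    by rewrite [ltLHS](int _ mabs (fun z => abse_ge0 (f z))).
  have ax x : C x -> a x < +oo by move=> /Cr /le_lt_trans; apply; exact: ltry.
  have ip : Q.-integrable C p.
    apply/integrableP; split; first exact: measurable_funTS.
    apply: le_lt_trans intC; apply: ge0_le_integral => //.
    + by apply: measurableT_comp => //; exact: measurable_funTS.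
    + exact: measurable_funTS.
    + by move=> x _; rewrite gee0_abs.
  have in_ : Q.-integrable C n.
    apply/integrableP; split; first exact: measurable_funTS.
    apply: le_lt_trans intC; apply: ge0_le_integral => //.
    + by apply: measurableT_comp => //; exact: measurable_funTS.
    + exact: measurable_funTS.
    + by move=> x _; rewrite gee0_abs.
  split => //.
    apply: eq_integrable (integrableB mC ip in_) => //.
    by move=> x /set_mem/ax/m0E /= ->.
  rewrite integralE.
  under eq_integral do rewrite (funepos_comp f Z)/=.
  under [Y in _ - Y]eq_integral do rewrite (funeneg_comp f Z)/=.
  rewrite (int _ mp)// (int _ mn)// -integralB//.
  by apply: eq_integral => x /set_mem/ax/m0E ->.
apply: filterS km => x [/integrableP[_ ax] intm].
by apply: EFin_inj; rewrite m0E// -intm integralE.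
Qed.

(** The two means may come from different kernels, so linearity is used on integrals over events of
    [X]. Where [b1 \+ b2] is bounded, each bound is, and both variables are integrable. *)
Lemma local_cond_meanB (P : probability Omega R) (Q : probability T R)
    (X : Omega -> T) (Z1 Z2 : Omega -> R) (m1 m2 : T -> R) (b1 b2 : T -> \bar R)
    (c : R) :
  measurable_fun setT X -> Q = pushforward P X :> (set T -> \bar R) ->
  local_cond_mean P Q Z1 X m1 b1 -> local_cond_mean P Q Z2 X m2 b2 ->
  local_cond_mean P Q (fun w => Z1 w - Z2 w - c)%R X
    (fun x => m1 x - m2 x - c)%R (b1 \+ b2).
Proof.
move=> mX QE [[mZ1 mm1] mb1 b10 b1y H1] [[mZ2 mm2] mb2 b20 b2y H2].
split.
- by split; apply: measurable_funB => //; exact: measurable_funB.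
- exact: emeasurable_funD.
- by move=> x; exact: adde_ge0.
- by apply: filterS2 b1y b2y => x; exact: lte_add_pinfty.
move=> r C mC Cr.
have mXC : measurable (X @^-1` C).
  by rewrite -[Y in measurable Y]setTI; exact: mX.
have [|iZ1 im1 E1] := H1 r C mC.
  by move=> x /Cr; apply: le_trans; rewrite leeDl.
have [|iZ2 im2 E2] := H2 r C mC.
  by move=> x /Cr; apply: le_trans; rewrite leeDr.
have icP : P.-integrable (X @^-1` C) (cst c%:E).
  by apply: finite_measure_integrable_cst.
have icQ : Q.-integrable C (cst c%:E).
  by apply: finite_measure_integrable_cst.
have iZ12 := integrableB mXC iZ1 iZ2.
have im12 := integrableB mC im1 im2.
split.
- exact: eq_integrable (integrableB mXC iZ12 icP).
- exact: eq_integrable (integrableB mC im12 icQ).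
transitivity (\int[P]_(w in X @^-1` C)
    (((EFin \o Z1) \- (EFin \o Z2)) \- cst c%:E) w).
  by apply: eq_integral.
transitivity (\int[Q]_(x in C)
    (((EFin \o m1) \- (EFin \o m2)) \- cst c%:E) x); last first.
  by apply: eq_integral.
rewrite integralB// integralB// [RHS]integralB// integralB//= E1 E2.
have QC : Q C = P (X @^-1` C) by rewrite QE.
by rewrite !integral_cst//; congr (_ - c%:E * _); exact: esym QC.
Qed.

End local_cond_mean.

(** The integral of a variable over an event of [X] depends only on their joint law. Hence [m1] and
    [m2] have equal integrals over all measurable subsets of each [D n], and the [D n] exhaust the
    space up to a null set. *)
Lemma local_cond_mean_unique {d1 d2 d'} {Omega1 : measurableType d1}
    {Omega2 : measurableType d2} {T : measurableType d'} {R : realType}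
    (P1 : probability Omega1 R) (P2 : probability Omega2 R)
    (Q1 Q2 : probability T R) (Z1 : Omega1 -> R) (Z2 : Omega2 -> R)
    (X1 : Omega1 -> T) (X2 : Omega2 -> T) (m1 m2 : T -> R)
    (b1 b2 : T -> \bar R) :
  measurable_fun setT X1 -> measurable_fun setT X2 ->
  (forall C, measurable C -> Q1 C = Q2 C) ->
  (forall C : set (R * T), measurable C ->
     P1 [set w | C (Z1 w, X1 w)] = P2 [set w | C (Z2 w, X2 w)]) ->
  local_cond_mean P1 Q1 Z1 X1 m1 b1 -> local_cond_mean P2 Q2 Z2 X2 m2 b2 ->
  {ae Q1, forall x, m1 x = m2 x}.
Proof.
move=> mX1 mX2 Q12 P12 [[mZ1 mm1] mb1 b10 b1y H1] [[mZ2 mm2] mb2 b20 b2y H2].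
have b2y1 : {ae Q1, forall x, (b2 x < +oo)%E}.
  have [N [mN N0 bN]] := b2y; exists N; split => //.
  by rewrite -N0; exact: Q12.
have [M1 M1E] := exists_law P1 (measurable_fun_pair mZ1 mX1).
have [M2 M2E] := exists_law P2 (measurable_fun_pair mZ2 mX2).
pose D n := [set x | (b1 x + b2 x <= n%:R%:E)%E].
have mD n : measurable (D n).
  rewrite -[Y in measurable Y]setTI; apply: emeasurable_fun_infty_c => //.
  exact: emeasurable_funD.
have Dae n : ae_eq Q1 (D n) (EFin \o m1) (EFin \o m2).
  have D1 x : D n x -> (b1 x <= n%:R%:E)%E by apply: le_trans; rewrite leeDl.
  have D2 x : D n x -> (b2 x <= n%:R%:E)%E by apply: le_trans; rewrite leeDr.
  have [_ im1 _] := H1 _ _ (mD n) D1.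
  apply: integral_ae_eq => //.
    by apply/measurable_EFinP; exact: measurable_funTS.
  move=> E ED mE.
  have [i1 _ <-] := H1 _ _ mE (fun x Ex => D1 x (ED x Ex)).
  rewrite (eq_measure_integral Q2); last by move=> A mA _; exact: Q12.
  have [i2 _ <-] := H2 _ _ mE (fun x Ex => D2 x (ED x Ex)).
  have mE' : measurable (snd @^-1` E : set (R * T)).
    by rewrite -[Y in measurable Y]setTI; exact: measurable_snd.
  have mfst : measurable_fun setT (fun z : R * T => z.1%:E).
    by apply/measurable_EFinP; exact: measurable_fst.
  rewrite -[LHS](integral_pushforward (measurable_fun_pair mZ1 mX1)
    mfst i1 mE').
  rewrite -[RHS](integral_pushforward (measurable_fun_pair mZ2 mX2)
    mfst i2 mE').
  rewrite -M1E -M2E; apply: eq_measure_integral => A mA _.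
  transitivity (pushforward P1 (fun w => (Z1 w, X1 w)) A); first by rewrite -M1E.
  transitivity (pushforward P2 (fun w => (Z2 w, X2 w)) A); last by rewrite -M2E.
  exact: P12.
have all_ae : {ae Q1, forall x, forall n, D n x -> m1 x = m2 x}.
  apply/ae_foralln => n; apply: filterS (Dae n) => x H Dx.
  by apply: EFin_inj; exact: H.
apply: filterS3 all_ae b1y b2y1 => x Dx b1x b2x.
have b12fin : (b1 x + b2 x)%E \is a fin_num.
  by rewrite ge0_fin_numE ?adde_ge0// lte_add_pinfty.
(* The truncation plus one is an integer above the finite value of b1 + b2. *)
apply: (Dx (Num.truncn (fine (b1 x + b2 x)%E)).+1).
rewrite /D/= -[leLHS]fineK// lee_fin ltW//.
have b12_ge0 := fine_ge0 (adde_ge0 (b10 x) (b20 x)).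
by have /andP[] := truncn_itv b12_ge0.
Qed.

(** * The change in the conditional mean *)

Section conditional_mean_change.
Context {R : realType} {K : nat}.
Implicit Types s : structure R K.

Lemma g_latentE s y0 t (w : outcomes R K) : A4a s ->
  g s y0 t (Y s t w) - Xbeta s t w = alpha w - U t w - hinv s t1 y0.
Proof. by move=> sA4a; rewrite /g /Y hinvK//; ring. Qed.

Lemma cond_mean_local_effect s t (mu : covariates R K -> R) (m c : R)
    (Q : probability (covariates R K) R) :
  Q = law_X s :> (set _ -> \bar R) ->
  is_cond_mean (joint s) alpha Xall mu ->
  is_cond_mean (joint s) (U t) Xall (fun=> m) ->
  exists nu b, local_cond_mean (joint s) Q
      (fun w => alpha w - U t w - c) Xall nu b /\
    {ae Q, forall x, nu x = mu x - m - c}.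
Proof.
move=> QE hmu hm.
have [mu0 [b1 [loc1 E1]]] :=
  cond_mean_local measurable_alpha measurable_Xall QE hmu.
have [m0 [b2 [loc2 E2]]] :=
  cond_mean_local (measurable_U t) measurable_Xall QE hm.
exists (fun x => mu0 x - m0 x - c), (b1 \+ b2)%E; split.
  exact: local_cond_meanB measurable_Xall QE loc1 loc2.
by apply: filterS2 E1 E2 => x -> ->.
Qed.

(** An additive constant cancels in differences; the exceptional set is where the shift relation
    fails. *)
Lemma ae_equal_shift s (Q : probability (covariates R K) R)
    (f f' : covariates R K -> R) (c : R) :
  Q = law_X s :> (set _ -> \bar R) ->
  {ae Q, forall x, f x = f' x + c} ->
  ae_equal s (fun x x' => f x - f x') (fun x x' => f' x - f' x').
Proof.
move=> QE ff'; exists (~` [set x | f x = f' x + c]).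
split; first by rewrite -QE.
move=> x x' [_ /contrapT/= ->] [_ /contrapT/= ->]; ring.
Qed.

(** With h = h_2(. + c_1), the variable alpha - U_2 - c_1 equals h^{-1}(Y_2) - X_2 beta. Both h and
    beta are common to the two structures, so one map [G] of the observables serves both. *)
Lemma same_effect_law (Ysupp : set R) s s' y0 : under Ysupp y0 ->
  admissible Ysupp s -> admissible Ysupp s' -> same_observables s s' ->
  forall C : set (R * covariates R K), measurable C ->
  joint s [set w | C (alpha w - U t2 w - hinv s t1 y0, Xall w)] =
  joint s' [set w | C (alpha w - U t2 w - hinv s' t1 y0, Xall w)].
Proof.
move=> hy0 [sA1 sA2 [sA3i sA3ii] sA4 [sA4a _]].
move=> [s'A1 s'A2 _ s'A4 [s'A4a _]] ss' C mC.
have [b1 _] := sA4 _ _ hy0 hy0; have [b'1 _] := s'A4 _ _ hy0 hy0.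
have idb z z' := @identified_beta _ _ s s' z z' sA2 s'A2 sA3i sA3ii sA4a s'A4a
  b1 b'1 ss'.
have [rs _ _ _] := sA1 t1; have [rs' _ _ _] := s'A1 t1.
have [y0Y _] := hy0.
have [z0 _ z0E] : range (trans s t1) y0 by rewrite rs.
have [z0' _ z0'E] : range (trans s' t1) y0 by rewrite rs'.
have htrans := identified_trans sA1 s'A1
  (fun z z' H => (idb z z' H).2) z0E z0'E.
have c0 : hinv s t1 y0 = z0 by rewrite -z0E hinvK.
have c0' : hinv s' t1 y0 = z0' by rewrite -z0'E hinvK.
(* The period 2 thresholds are written [0 + z0] and [0 + z0'] so that [htrans] at 0 equates their
   outcomes. *)
have bb : beta s = beta s'.
  apply: (idb (fun t => if t is t1 then z0 else 0 + z0)
    (fun t => if t is t1 then z0' else 0 + z0') _).1.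
  by case; rewrite ?z0E ?z0'E.
pose h z := trans s t2 (z + z0).
have mh : {mono h : x y / x <= y}.
  by move=> x y; rewrite /h strict_le_mono// lerD2r.
pose G (o : (R * R) * covariates R K) :=
  (lower_inv h o.1.2 - xbeta s t2 o.2, o.2).
have mG : measurable_fun setT G.
  apply: measurable_fun_pair; last exact: measurable_snd.
  apply: measurable_funB.
    apply: measurableT_comp (measurable_lower_inv h) _.
    exact: measurableT_comp measurable_snd measurable_fst.
  exact: measurableT_comp (measurable_xbeta s t2) measurable_snd.
have mGC : measurable (G @^-1` C).
  by rewrite -[Y in measurable Y]setTI; exact: mG.
rewrite c0 c0'.
have -> : [set w | C (alpha w - U t2 w - z0, Xall w)] =
    observables s @^-1` (G @^-1` C).
  apply/funext => w; rewrite /= /G/=; congr (C (_, _)).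
  have -> : Y s t2 w = h (alpha w + Xbeta s t2 w - U t2 w - z0).
    by rewrite /h subrK.
  by rewrite lower_invK// /xbeta /Xbeta /X; ring.
have -> : [set w | C (alpha w - U t2 w - z0', Xall w)] =
    observables s' @^-1` (G @^-1` C).
  apply/funext => w; rewrite /= /G/=; congr (C (_, _)).
  (* By [htrans], the function h defined from [s] also represents the outcomes of [s']. *)
  have -> : Y s' t2 w = h (alpha w + Xbeta s' t2 w - U t2 w - z0').
    by rewrite /h htrans subrK.
  by rewrite lower_invK// /xbeta /Xbeta /X bb; ring.
exact: ss'.
Qed.

End conditional_mean_change.

Theorem theorem4 (R : realType) (K : nat) (Ysupp : set R) (y0 : R)
    (hy0 : under Ysupp y0) :
  identified (@admissible R K Ysupp) (fun s => is_cond_mean_diff s alpha) /\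
  (forall s : structure R K, admissible Ysupp s ->
   forall mu : covariates R K -> R, is_cond_mean (joint s) alpha Xall mu ->
   forall (t : period) (xi : covariates R K -> R),
     is_cond_mean (joint s) (fun w => g s y0 t (Y s t w) - Xbeta s t w) Xall xi ->
   ae_equal s (fun x x' => mu x - mu x') (fun x x' => xi x - xi x')).
Proof.
split.
  move=> s s' adm adm' ss' _ _ [mu [hmu ->]] [mu' [hmu' ->]].
  have [_ _ _ _ [_ [m hm]]] := adm; have [_ _ _ _ [_ [m' hm']]] := adm'.
  have [Q QE] := exists_law (joint s) measurable_Xall.
  have [Q' Q'E] := exists_law (joint s') measurable_Xall.
  have [nu [b [loc nuE]]] :=
    cond_mean_local_effect (hinv s t1 y0) QE hmu (hm t2).
  have [nu' [b' [loc' nu'E]]] :=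
    cond_mean_local_effect (hinv s' t1 y0) Q'E hmu' (hm' t2).
  have QQ' C : measurable C -> Q C = Q' C.
    move=> mC; transitivity (joint s (Xall @^-1` C)); first by rewrite QE.
    by rewrite (same_observables_X ss' mC) Q'E.
  (* The null set is carried from [Q'] to [Q], which agree on measurable sets. *)
  have nu'E1 : {ae Q, forall x, nu' x = mu' x - m' - hinv s' t1 y0}.
    have [N [mN N0 AN]] := nu'E; exists N; split => //.
    by rewrite -N0; exact: QQ'.
  have nunu' := local_cond_mean_unique measurable_Xall measurable_Xall QQ'
    (same_effect_law hy0 adm adm' ss') loc loc'.
  (* Here mu = nu + m + c_1, mu' = nu' + m' + c_1', and nu = nu' almost everywhere. *)
  apply: (ae_equal_shift (c := m + hinv s t1 y0 - m' - hinv s' t1 y0) QE).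
  by apply: filterS3 nuE nu'E1 nunu' => x -> ->; lra.
move=> s adm mu hmu t xi hxi.
have [_ _ _ _ [sA4a [m hm]]] := adm.
have [Q QE] := exists_law (joint s) measurable_Xall.
have [nu [b [loc nuE]]] := cond_mean_local_effect (hinv s t1 y0) QE hmu (hm t).
have mT : measurable_fun setT
    (fun w : outcomes R K => alpha w - U t w - hinv s t1 y0).
  by have [[]] := loc.
rewrite (_ : (fun w => _) =
  (fun w => alpha w - U t w - hinv s t1 y0)) in hxi; last first.
  by apply/funext => w; exact: g_latentE.
have [xi0 [b' [loc' xiE]]] := cond_mean_local mT measurable_Xall QE hxi.
(* Uniqueness within the single structure [s]: nu and xi0 are both conditional means of alpha - U_t
   - c_1. *)
have nuxi := local_cond_mean_unique measurable_Xall measurable_Xall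
  (fun C _ => erefl) (fun C _ => erefl) loc loc'.
apply: (ae_equal_shift (c := m + hinv s t1 y0) QE).
by apply: filterS3 nuE xiE nuxi => x -> ->; lra.
Qed.
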